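(* Let $X$ and $Y$ be topological spaces and let $f:X\to Y$ be a continuous surjection. (a) If $X$ is normal and $f$ is $ge^*\theta$-closed, then $Y$ is $e^*\theta$-normal. (b) If $X$ is $e^*\theta$-normal and $f$ is pre $ge^*\theta$-closed, then $Y$ is $e^*\theta$-normal.
   Context: For a subset $A$ of a topological space $X$, $cl(A)$ and $int(A)$ denote closure and interior. The $\delta$-closure $cl_\delta(A)$ is the set of points $x\in X$ such that $int(cl(U))\cap A\neq\emptyset$ for every open $U$ containing $x$. $A$ is $e^*$-open if $A\subseteq cl(int(cl_\delta(A)))$; complements of $e^*$-open sets are $e^*$-closed; $e^*\text{-}cl(A)$ is the intersection of all $e^*$-closed sets containing $A$. The $e^*$-$\theta$-closure $e^*\text{-}cl_\theta(A)$ is the set of points $x\in X$ such that $e^*\text{-}cl(U)\cap A\neq\emptyset$ for every $e^*$-open set $U$ containing $x$. $A$ is $e^*$-$\theta$-closed if $A=e^*\text{-}cl_\theta(A)$; complements of $e^*$-$\theta$-closed sets are called $e^*$-$\theta$-open. $A$ is $ge^*\theta$-closed (generalized $e^*\theta$-closed) if $e^*\text{-}cl_\theta(A)\subseteq U$ whenever $A\subseteq U$ and $U$ is open in $X$. A function $f:X\to Y$ is $ge^*\theta$-closed if the image of each closed set of $X$ is $ge^*\theta$-closed in $Y$; it is pre $ge^*\theta$-closed if the image of each $ge^*\theta$-closed set of $X$ is $ge^*\theta$-closed in $Y$. A space is normal if disjoint closed sets can be separated by disjoint open sets (no $T_1$ assumption). A space is $e^*\theta$-normal if for any pair of disjoint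 closed sets $F_1$ and $F_2$ there exist disjoint $e^*$-$\theta$-open sets $U_1$ and $U_2$ with $F_1\subseteq U_1$ and $F_2\subseteq U_2$. *)

(* Defs.v *)
From mathcomp Require Import all_boot.
From mathcomp Require Import boolp classical_sets functions topology.
From mathcomp Require Import separation_axioms.

Set Implicit Arguments.
Unset Strict Implicit.
Unset Printing Implicit Defensive.

Local Open Scope classical_set_scope.

(* MathComp-Analysis; topological spaces are arbitrary [topologicalType]s,
   with no separation axiom. *)

Definition delta_closure (X : topologicalType) (A : set X) : set X :=
  [set x | forall U : set X, open U -> U x ->
     interior (closure U) `&` A !=set0].

Definition estar_open (X : topologicalType) (A : set X) : Prop :=
  A `<=` closure (interior (delta_closure A)).

Definition estar_closed (X : topologicalType) (A : set X) : Prop :=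
  estar_open (~` A).

Definition estar_closure (X : topologicalType) (A : set X) : set X :=
  \bigcap_(F in [set F : set X | estar_closed F /\ A `<=` F]) F.

Definition estar_theta_closure (X : topologicalType) (A : set X) : set X :=
  [set x | forall U : set X, estar_open U -> U x ->
     estar_closure U `&` A !=set0].

Definition estar_theta_closed (X : topologicalType) (A : set X) : Prop :=
  A = estar_theta_closure A.

Definition estar_theta_open (X : topologicalType) (A : set X) : Prop :=
  estar_theta_closed (~` A).

Definition gestar_theta_closed (X : topologicalType) (A : set X) : Prop :=
  forall U : set X, open U -> A `<=` U -> estar_theta_closure A `<=` U.

Definition gestar_theta_closed_fun (X Y : topologicalType) (f : X -> Y) : Prop :=
  forall A : set X, closed A -> gestar_theta_closed (f @` A).

Definition pre_gestar_theta_closed_fun (X Y : topologicalType) (f : X -> Y) :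
    Prop :=
  forall A : set X, gestar_theta_closed A -> gestar_theta_closed (f @` A).

Definition estar_theta_normal (X : topologicalType) : Prop :=
  forall F1 F2 : set X, closed F1 -> closed F2 -> F1 `&` F2 = set0 ->
  exists U1 U2 : set X,
    [/\ estar_theta_open U1, estar_theta_open U2,
        F1 `<=` U1, F2 `<=` U2 & U1 `&` U2 = set0].

(* The library's [normal_space] is phrased with closed neighborhoods; it
   amounts to the separation of disjoint closed sets by disjoint open sets,
   without any T1 assumption. *)
Lemma normal_space_separation (X : topologicalType) :
  normal_space X <->
  forall F1 F2 : set X, closed F1 -> closed F2 -> F1 `&` F2 = set0 ->
  exists U1 U2 : set X,
    [/\ open U1, open U2, F1 `<=` U1, F2 `<=` U2 & U1 `&` U2 = set0].
Proof.
split=> [nX F1 F2 cF1 cF2 F120|sepX A cA B /set_nbhsP[C [oC AC CB]]].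
  have nF1 : set_nbhs F1 (~` F2).
    apply/set_nbhsP; exists (~` F2); split => //; first exact: closed_openC.
    exact/disjoints_subset.
  have [V /set_nbhsP[U [oU F1U UV]] VF2] := nX _ cF1 _ nF1.
  exists U, (~` closure V); split => //.
  - by apply: closed_openC; exact: closed_closure.
  - exact: (subsetCr VF2).
  - by apply/disjoints_subset; rewrite setCK => x /UV; exact: subset_closure.
have AC0 : A `&` ~` C = set0 by apply/disjoints_subset; rewrite setCK.
have [U [V [oU oV AU CV UV0]]] := sepX _ _ cA (open_closedC oC) AC0.
exists U; first by apply/set_nbhsP; exists U; split.
apply: subset_trans CB => x Ux; apply: contrapT => /CV Vx.
have [y [Uy Vy]] := Ux _ (open_nbhs_nbhs (conj oV Vx)).
by have : (U `&` V) y by []; rewrite UV0.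
Qed.

(* Main.v *)
(** The crux is that the e*-theta-closure operator is idempotent, unlike the
    ordinary theta-closure, because the e*-closure of an e*-open set is again
    e*-open. Hence, if [U] contains the preimage of a closed set [F] and the
    image of the complement of [U] is ge*theta-closed, then the complement of
    the e*-theta-closure of this image is an e*-theta-open set containing
    [F]. Surjectivity makes the two sets obtained from disjoint [U1] and [U2]
    disjoint. *)
Require Import Defs.
From mathcomp Require Import all_boot.
From mathcomp Require Import boolp classical_sets functions topology.
From mathcomp Require Import separation_axioms.

Local Open Scope classical_set_scope.

Section EstarClosure.
Context {X : topologicalType}.
Implicit Types A B U C : set X.

Lemma subset_delta_closure A : A `<=` delta_closure A.
Proof.
move=> x Ax U oU Ux; exists x; split => //.
have : U `<=` interior (closure U).
  by rewrite -open_subsetE //; exact: subset_closure.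
exact.
Qed.

Lemma delta_closureS A B : A `<=` B -> delta_closure A `<=` delta_closure B.
Proof.
by move=> AB x Ax U oU Ux; have [y [Uy /AB By]] := Ax U oU Ux; exists y.
Qed.

Lemma open_estar_open U : open U -> estar_open U.
Proof.
move=> oU; apply: subset_trans (@subset_closure _ _).
by rewrite -open_subsetE //; exact: subset_delta_closure.
Qed.

Lemma closed_estar_closed C : closed C -> estar_closed C.
Proof. by move=> cC; apply: open_estar_open; exact: closed_openC. Qed.

Lemma subset_estar_closure A : A `<=` estar_closure A.
Proof. by move=> x Ax F [_ /(_ _ Ax)]. Qed.

Lemma estar_closure_min A C :
  estar_closed C -> A `<=` C -> estar_closure A `<=` C.
Proof. by move=> cC AC x /(_ C); apply. Qed.

Lemma estar_closure_idem_sub A :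
  estar_closure (estar_closure A) `<=` estar_closure A.
Proof.
by move=> x clx F [cF AF]; apply: clx; split => //; exact: estar_closure_min.
Qed.

(** The set [closure (interior (delta_closure U))] is closed, hence e*-closed, and contains [U], so
    it also contains [estar_closure U]. Monotonicity then allows [delta_closure U] to be enlarged to
    [delta_closure (estar_closure U)]. *)
Lemma estar_closure_open U : estar_open U -> estar_open (estar_closure U).
Proof.
move=> oU.
have clU : estar_closure U `<=` closure (interior (delta_closure U)).
  apply: estar_closure_min oU.
  by apply: closed_estar_closed; exact: closed_closure.
apply: (subset_trans clU); apply: closureS; apply: interiorS.
by apply: delta_closureS; exact: subset_estar_closure.
Qed.

Lemma subset_estar_theta_closure A : A `<=` estar_theta_closure A.
Proof.
by move=> x Ax U _ Ux; exists x; split => //; exact: subset_estar_closure.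
Qed.

Lemma estar_theta_closure_closed A :
  estar_theta_closed (estar_theta_closure A).
Proof.
apply/seteqP; split; first exact: subset_estar_theta_closure.
move=> x clx U oU Ux; have [y [Uy cly]] := clx U oU Ux.
(* The e*-closure of [U] is itself an admissible e*-open set around [y], so [cly] can be tested on
   it. *)
have [z [Uz Az]] := cly _ (estar_closure_open _ oU) Uy.
by exists z; split => //; exact: estar_closure_idem_sub.
Qed.

Lemma estar_theta_closed_gestar A :
  estar_theta_closed A -> gestar_theta_closed A.
Proof. by move=> cA U _; rewrite -cA. Qed.

Lemma gestar_theta_closedC_nbhs A F :
  gestar_theta_closed A -> closed F -> A `&` F = set0 ->
  exists U, [/\ estar_theta_open U, F `<=` U & U `<=` ~` A].
Proof.
move=> gA cF AF0; exists (~` estar_theta_closure A); split.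
- by rewrite /estar_theta_open setCK; exact: estar_theta_closure_closed.
- apply: subsetCr; apply: gA; first exact: closed_openC.
  exact/disjoints_subset.
- by apply: subsetC; exact: subset_estar_theta_closure.
Qed.

End EstarClosure.

(** Common core of both parts: the topology of [X] enters only through the images of [~]
    U1[and]~[U2], so [U1] and [U2] may be open or e*-theta-open. *)
Lemma estar_theta_separation_image (X Y : topologicalType) (f : X -> Y)
    (U1 U2 : set X) (F1 F2 : set Y) :
  set_surj [set: X] [set: Y] f -> closed F1 -> closed F2 ->
  gestar_theta_closed (f @` (~` U1)) -> gestar_theta_closed (f @` (~` U2)) ->
  f @^-1` F1 `<=` U1 -> f @^-1` F2 `<=` U2 -> U1 `&` U2 = set0 ->
  exists V1 V2 : set Y,
    [/\ estar_theta_open V1, estar_theta_open V2,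
        F1 `<=` V1, F2 `<=` V2 & V1 `&` V2 = set0].
Proof.
move=> fsurj cF1 cF2 g1 g2 FU1 FU2 U120.
have image_disj (U : set X) (F : set Y) :
    f @^-1` F `<=` U -> f @` (~` U) `&` F = set0.
  by move=> FU; apply/seteqP; split => // y [[x nUx <-]] /FU /nUx.
have [V1 [oV1 FV1 VU1]] :=
  gestar_theta_closedC_nbhs _ _ g1 cF1 (image_disj _ _ FU1).
have [V2 [oV2 FV2 VU2]] :=
  gestar_theta_closedC_nbhs _ _ g2 cF2 (image_disj _ _ FU2).
exists V1, V2; split => //; apply/seteqP; split => // y [/VU1 nU1 /VU2 nU2].
have [x _ fxy] := fsurj y I.
have : (U1 `&` U2) x.
  by split; apply: contrapT => nUx; [apply: nU1 | apply: nU2]; exists x.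
by rewrite U120.
Qed.

Theorem theorem9 (X Y : topologicalType) (f : X -> Y)
    (fcont : continuous f) (fsurj : set_surj [set: X] [set: Y] f) :
  (normal_space X -> gestar_theta_closed_fun f -> estar_theta_normal Y) /\
  (estar_theta_normal X -> pre_gestar_theta_closed_fun f ->
     estar_theta_normal Y).
Proof.
have cpre (F : set Y) : closed F -> closed (f @^-1` F).
  by move=> cF; exact: (continuous_closedP f).1.
have pre0 (F1 F2 : set Y) : F1 `&` F2 = set0 ->
    f @^-1` F1 `&` f @^-1` F2 = set0.
  by move=> F0; rewrite -preimage_setI F0 preimage_set0.
split=> [/normal_space_separation nX gf|nX gf] F1 F2 cF1 cF2 F120;
    have [U1 [U2 [oU1 oU2 FU1 FU2 U120]]] :=
      nX _ _ (cpre _ cF1) (cpre _ cF2) (pre0 _ _ F120).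
- by apply: (estar_theta_separation_image _ _ f U1 U2) => //;
    apply: gf; exact: open_closedC.
(* Here [~] U1[and]~[U2] are e*-theta-closed by definition, hence ge*theta-closed, as the
   pre-closedness of [f] demands. *)
- by apply: (estar_theta_separation_image _ _ f U1 U2) => //;
    apply: gf; exact: estar_theta_closed_gestar.
Qed.
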